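(* Let $N\ge 3$, $\kappa>0$, $\alpha\in\mathbb R$, $1\le m\le N$. Let $\theta_1(t),\dots,\theta_N(t)$, $t\ge 0$, be the real-valued solution of $$\dot\theta_j=\frac{\kappa}{N}\sum_{k=1}^N\sin(\theta_k-\theta_j+\alpha),\qquad \theta_j(0)=\theta_j^0,\qquad j=1,\dots,N,$$ where $\theta_j^0=\theta_N^0$ for $j=N-m+1,\dots,N$ and $\theta_j^0\not\equiv\theta_N^0\pmod{2\pi}$ for $j=1,\dots,N-m$. For $j=1,\dots,N-m$ set $$x_j(t):=\frac{\sin(\theta_j(t)-\theta_N(t))}{1-\cos(\theta_j(t)-\theta_N(t))}.$$ Then $\{x_j\}_{j=1}^{N-m}$ satisfies $$\dot x_j=\mathcal A+\mathcal B\,x_j,\quad t>0,\qquad x_j(0)=\frac{\sin(\theta_j^0-\theta_N^0)}{1-\cos(\theta_j^0-\theta_N^0)},\qquad j=1,\dots,N-m,$$ where $$\mathcal A=\frac{\kappa}{N}\left[m\sin\alpha+\sum_{k=1}^{N-m}\left(\frac{2x_k}{x_k^2+1}\cos\alpha+\frac{x_k^2-1}{x_k^2+1}\sin\alpha\right)\right],$$ $$\mathcal B=\frac{\kappa}{N}\left[m\cos\alpha+\sum_{k=1}^{N-m}\left(-\frac{2x_k}{x_k^2+1}\sin\alpha+\frac{x_k^2-1}{x_k^2+1}\cos\alpha\right)\right].$$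
   Context: By uniqueness of solutions, for all $t\ge0$ one has $\theta_j(t)=\theta_N(t)$ for $j>N-m$ and $\theta_j(t)\not\equiv\theta_N(t)\pmod{2\pi}$ for $j\le N-m$, so the $x_j(t)$ are well defined. Where $\sin\beta\neq0$, $\frac{\sin\beta}{1-\cos\beta}=\frac{1+\cos\beta}{\sin\beta}$. *)

(* Defs.v *)
From Stdlib Require Import Reals.
From Coquelicot Require Import Coquelicot.
Open Scope R_scope.

Definition congr_2PI (a b : R) : Prop :=
  exists z : Z, a - b = 2 * PI * IZR z.

(* Families are indexed by 1, ..., n as in the text; values of [y] at other
   indices are irrelevant.  The initial value is attained continuously: [y] is
   continuous on the half-line [0, +oo), relative to it at 0.  When [F] is
   continuous this makes the right derivative at 0 exist and satisfy the
   equation there too. *)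
Definition solves_ivp (n : nat) (F : (nat -> R) -> nat -> R)
    (y0 : nat -> R) (y : nat -> R -> R) : Prop :=
  forall j : nat, (1 <= j <= n)%nat ->
    continuous_on (fun t => 0 <= t) (y j) /\
    (forall t, 0 < t -> is_derive (y j) t (F (fun k => y k t) j)) /\
    y j 0 = y0 j.

Definition sakaguchi_kuramoto (N : nat) (kappa alpha : R)
    (th : nat -> R) (j : nat) : R :=
  kappa / INR N * sum_n_m (fun k => sin (th k - th j + alpha)) 1 N.

Definition sin_ratio (beta : R) : R := sin beta / (1 - cos beta).

(* [sum_n_m _ 1 (N - m)] is the empty sum, hence 0, when m = N. *)
Definition calA (N m : nat) (kappa alpha : R) (x : nat -> R) : R :=
  kappa / INR N *
    (INR m * sin alpha +
     sum_n_m (fun k => 2 * x k / (x k ^ 2 + 1) * cos alpha +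
                       (x k ^ 2 - 1) / (x k ^ 2 + 1) * sin alpha) 1 (N - m)).

Definition calB (N m : nat) (kappa alpha : R) (x : nat -> R) : R :=
  kappa / INR N *
    (INR m * cos alpha +
     sum_n_m (fun k => - (2 * x k / (x k ^ 2 + 1)) * sin alpha +
                       (x k ^ 2 - 1) / (x k ^ 2 + 1) * cos alpha) 1 (N - m)).

(* Main.v *)
(** Write [beta = theta_j - theta_N].  Subtracting the equations for [theta_j]
    and [theta_N] gives [beta' = - P (1 - cos beta) - Q sin beta], where [P] and
    [Q] are [kappa / N] times the sums of the sines and of the cosines of
    [theta_k - theta_N + alpha]; dividing by [-(1 - cos beta)] yields
    [x_j' = P + Q x_j].  Instead of a general uniqueness theorem, one uses that
    [g = 1 - cos beta] solves the linear equation
    [g' = - (P sin beta + Q (1 + cos beta)) g] with a bounded coefficient, so by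
    Gronwall [g] vanishes identically if [g 0 = 0] and never if [g 0 > 0].
    The half-angle formulas, with [x_k = cot ((theta_k - theta_N) / 2)], then
    identify [P] with [calA] and [Q] with [calB]. *)

Require Import Defs.
From Stdlib Require Import Reals Lra Lia.
From Coquelicot Require Import Coquelicot.
Open Scope R_scope.

(** * Continuity relative to the closed half-line *)

(** Precomposition with [Rabs] extends a function on the half-line evenly, which turns one-sided
    continuity at 0 into the two-sided continuity that [MVT_gen] asks for. *)
Lemma continuous_on_Rabs (f : R -> R) (hf : continuous_on (fun t => 0 <= t) f) (x : R) :
  continuous (fun t => f (Rabs t)) x.
Proof.
  unfold continuous.
  apply filterlim_comp with (within (fun t => 0 <= t) (locally (Rabs x))).
  - intros P HP.
    generalize (continuous_Rabs x _ HP); unfold filtermap.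
    apply filter_imp; intros t Ht; apply Ht, Rabs_pos.
  - apply hf, Rabs_pos.
Qed.

Lemma continuous_on_comp_pt (D : R -> Prop) (f h : R -> R)
    (hf : continuous_on D f) (hh : forall x, D x -> continuous h (f x)) :
  continuous_on D (fun t => h (f t)).
Proof.
  intros x Dx.
  apply filterlim_comp with (locally (f x)); [apply hf | apply hh]; exact Dx.
Qed.

Lemma continuous_on_op2 (D : R -> Prop) (op : R -> R -> R) (f g : R -> R)
    (hop : forall a b, filterlim (fun z => op (fst z) (snd z))
             (filter_prod (locally a) (locally b)) (locally (op a b)))
    (hf : continuous_on D f) (hg : continuous_on D g) :
  continuous_on D (fun t => op (f t) (g t)).
Proof.
  intros x Dx.
  apply (filterlim_comp_2 (G := locally (f x)) (H := locally (g x))).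
  - apply hf, Dx.
  - apply hg, Dx.
  - apply hop.
Qed.

Lemma continuous_on_Rmult (D : R -> Prop) (f g : R -> R)
    (hf : continuous_on D f) (hg : continuous_on D g) :
  continuous_on D (fun t => f t * g t).
Proof.
  apply (continuous_on_op2 D Rmult); [ | exact hf | exact hg].
  intros a b; apply (filterlim_mult (K := R_AbsRing)).
Qed.

Lemma continuous_on_Rminus (D : R -> Prop) (f g : R -> R)
    (hf : continuous_on D f) (hg : continuous_on D g) :
  continuous_on D (fun t => f t - g t).
Proof.
  apply (continuous_on_op2 D Rplus f (fun t => - g t)); [ | exact hf | ].
  - intros a b; apply (filterlim_plus (K := R_AbsRing) (V := R_NormedModule)).
  - apply (continuous_on_comp_pt D g Ropp hg).
    intros x _; apply (filterlim_opp (K := R_AbsRing) (V := R_NormedModule)).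
Qed.

(** * Gronwall bounds for a scalar linear equation *)

Lemma derive_nonpos_le_init (f df : R -> R)
    (hc : continuous_on (fun t => 0 <= t) f)
    (hd : forall t, 0 < t -> is_derive f t (df t))
    (hneg : forall t, 0 < t -> df t <= 0) (t : R) (ht : 0 <= t) :
  f t <= f 0.
Proof.
  destruct (Rle_lt_or_eq_dec _ _ ht) as [tpos | <-]; [ | lra].
  (* The point [c] may be the endpoint 0, where [df] is unconstrained. [Rmin (df s) 0] agrees with
     [df] inside the interval and is nonpositive everywhere. *)
  destruct (MVT_gen (fun s => f (Rabs s)) 0 t (fun s => Rmin (df s) 0))
    as [c [Hc E]].
  - intros s Hs; rewrite Rmin_left, Rmax_right in Hs by lra.
    rewrite Rmin_left by (apply hneg; lra).
    apply is_derive_ext_loc with f; [ | apply hd; lra].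
    apply (filter_imp (Rlt 0)); [ | apply open_gt; lra].
    intros u Hu; rewrite Rabs_pos_eq; [reflexivity | lra].
  - intros s _; apply continuity_pt_filterlim, (continuous_on_Rabs f hc).
  - rewrite Rabs_R0, Rabs_pos_eq in E by lra.
    pose proof (Rmin_r (df c) 0); nra.
Qed.

(** Integrating factors: since [g] is nonnegative and [c] lies in [-K, K], [g t * exp (K * t)] does
    not decrease and [g t * exp (- K * t)] does not increase. *)
Lemma linear_ode_bounds (g c : R -> R) (K : R)
    (hc : continuous_on (fun t => 0 <= t) g)
    (hd : forall t, 0 < t -> is_derive g t (c t * g t))
    (hK : forall t, Rabs (c t) <= K) (hpos : forall t, 0 <= g t)
    (t : R) (ht : 0 <= t) :
  g 0 * exp (- (K * t)) <= g t <= g 0 * exp (K * t).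
Proof.
  (* One monotonicity claim covers both bounds: [a] is a sign and [e] the exponent, with (-1, K) for
     the lower bound and (1, -K) for the upper. *)
  assert (H : forall a e : R, (forall s, a * (c s + e) <= 0) ->
            a * (g t * exp (e * t)) <= a * g 0).
  { intros a e hae.
    replace (a * g 0) with (a * (g 0 * exp (e * 0)))
      by (rewrite Rmult_0_r, exp_0; ring).
    apply (derive_nonpos_le_init (fun s => a * (g s * exp (e * s)))
             (fun s => a * (c s + e) * (g s * exp (e * s)))); [ | | | exact ht].
    - apply (continuous_on_Rmult _ (fun _ => a)).
      { intros x _; apply filterlim_const. }
      apply continuous_on_Rmult; [exact hc | ].
      apply continuous_on_forall; intros x _.
      apply (ex_derive_continuous (fun s => exp (e * s))); auto_derive; trivial.
    - intros s hs; pose proof (hd s hs) as D.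
      auto_derive; [exists (c s * g s); exact D | ].
      rewrite (is_derive_unique (fun x : R => g x) _ _ D); ring.
    - intros s _.
      pose proof (Rmult_le_pos _ _ (hpos s) (Rlt_le _ _ (exp_pos (e * s)))).
      specialize (hae s); nra. }
  assert (hcK : forall s, - K <= c s <= K) by (intros s; apply Rabs_le_between, hK).
  split.
  - assert (L := H (-1) K); specialize (L ltac:(intros s; specialize (hcK s); lra)).
    apply Rmult_le_reg_r with (exp (K * t)); [apply exp_pos | ].
    rewrite Rmult_assoc, <- exp_plus, Rplus_opp_l, exp_0; lra.
  - assert (U := H 1 (- K)); specialize (U ltac:(intros s; specialize (hcK s); lra)).
    apply Rmult_le_reg_r with (exp (- K * t)); [apply exp_pos | ].
    rewrite Rmult_assoc, <- exp_plus.
    replace (K * t + - K * t) with 0 by ring; rewrite exp_0; lra.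
Qed.

Lemma sum_n_m_abs_le (u : nat -> R) (N : nat) (hu : forall k, Rabs (u k) <= 1) :
  Rabs (sum_n_m u 1 N) <= INR N.
Proof.
  apply Rle_trans with (sum_n_m (fun k => Rabs (u k)) 1 N).
  { apply (norm_sum_n_m (K := R_AbsRing) u). }
  replace (INR N) with (sum_n_m (fun _ => 1) 1 N).
  { apply sum_n_m_le, hu. }
  rewrite sum_n_m_const, Rmult_1_r; f_equal; lia.
Qed.

(** * Half-angle identities and derivatives *)

Lemma one_sub_cos_nonneg (b : R) : 0 <= 1 - cos b.
Proof. pose proof (COS_bound b); lra. Qed.

(** By 1 - cos b = 2 sin^2 (b/2), half the difference is a zero of the sine, hence a multiple of
    pi. *)
Lemma one_sub_cos_eq0 (a b : R) : 1 - cos (a - b) = 0 -> congr_2PI a b.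
Proof.
  intros H.
  replace (a - b) with (2 * ((a - b) / 2)) in H by field.
  rewrite cos_2a_sin in H.
  destruct (sin_eq_0_0 ((a - b) / 2)) as [z Hz]; [nra | ].
  exists z; lra.
Qed.

Lemma sin_eq0_of_one_sub_cos_eq0 (b : R) : 1 - cos b = 0 -> sin b = 0.
Proof. intros H; pose proof (sin2_cos2 b); unfold Rsqr in *; nra. Qed.

(** From sin^2 = (1 - cos) (1 + cos), the squared ratio is (1 + cos) / (1 - cos). The two inversion
    formulas below follow from this. *)
Lemma sin_ratio_sqr_add1 (b : R) (hb : 1 - cos b <> 0) :
  sin_ratio b ^ 2 + 1 = 2 / (1 - cos b).
Proof.
  unfold sin_ratio.
  pose proof (sin2_cos2 b) as E; unfold Rsqr in E.
  replace ((sin b / (1 - cos b)) ^ 2) with (sin b * sin b / (1 - cos b) ^ 2)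
    by (field; exact hb).
  replace (sin b * sin b) with ((1 - cos b) * (1 + cos b)) by lra.
  field; exact hb.
Qed.

Lemma sin_of_sin_ratio (b : R) (hb : 1 - cos b <> 0) :
  2 * sin_ratio b / (sin_ratio b ^ 2 + 1) = sin b.
Proof.
  rewrite sin_ratio_sqr_add1 by exact hb.
  unfold sin_ratio; field; exact hb.
Qed.

Lemma cos_of_sin_ratio (b : R) (hb : 1 - cos b <> 0) :
  (sin_ratio b ^ 2 - 1) / (sin_ratio b ^ 2 + 1) = cos b.
Proof.
  replace (sin_ratio b ^ 2 - 1) with (sin_ratio b ^ 2 + 1 - 2) by ring.
  rewrite sin_ratio_sqr_add1 by exact hb.
  field; exact hb.
Qed.

Lemma is_derive_one_sub_cos (f : R -> R) (t l : R) (hf : is_derive f t l) :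
  is_derive (fun s => 1 - cos (f s)) t (l * sin (f t)).
Proof.
  auto_derive; [exists l; exact hf | ].
  rewrite (is_derive_unique (fun x : R => f x) _ _ hf); ring.
Qed.

Lemma is_derive_sin_ratio (f : R -> R) (t l : R)
    (hf : is_derive f t l) (hb : 1 - cos (f t) <> 0) :
  is_derive (fun s => sin_ratio (f s)) t (- l / (1 - cos (f t))).
Proof.
  unfold sin_ratio.
  auto_derive; [repeat split; (exact hb || (exists l; exact hf)) | ].
  rewrite (is_derive_unique (fun x : R => f x) _ _ hf).
  pose proof (sin2_cos2 (f t)) as E; unfold Rsqr in E.
  (* The quotient rule numerator is grouped to expose sin^2 + cos^2; what remains is cos - 1, which
     cancels one factor of the denominator. *)
  transitivity (l * (cos (f t) - (sin (f t) * sin (f t) + cos (f t) * cos (f t)))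
                  / (1 - cos (f t)) ^ 2); [ | rewrite E]; field; exact hb.
Qed.

(** * The mean field seen from oscillator [N] *)

(** With [mean_cos] as real part, this is the imaginary part of kappa e^(i alpha) times the Kuramoto
    order parameter in the frame of [th N]. Neither depends on [j], so all x_j share the same
    coefficients. *)
Definition mean_sin (N : nat) (kappa alpha : R) (th : nat -> R) : R :=
  kappa / INR N * sum_n_m (fun k => sin (th k - th N + alpha)) 1 N.

Definition mean_cos (N : nat) (kappa alpha : R) (th : nat -> R) : R :=
  kappa / INR N * sum_n_m (fun k => cos (th k - th N + alpha)) 1 N.

(** Writing th_k - th_j + alpha as (th_k - th_N + alpha) - b and expanding the sine makes the sum
    for [j] equal to cos b S - sin b C; the sum for [N] is S itself. *)
Lemma sakaguchi_kuramoto_sub (N : nat) (kappa alpha : R) (th : nat -> R) (j : nat) :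
  sakaguchi_kuramoto N kappa alpha th j - sakaguchi_kuramoto N kappa alpha th N =
  - mean_sin N kappa alpha th * (1 - cos (th j - th N))
  - mean_cos N kappa alpha th * sin (th j - th N).
Proof.
  unfold sakaguchi_kuramoto, mean_sin, mean_cos.
  set (b := th j - th N).
  set (S := sum_n_m (fun k => sin (th k - th N + alpha)) 1 N).
  set (C := sum_n_m (fun k => cos (th k - th N + alpha)) 1 N).
  assert (E : sum_n_m (fun k => sin (th k - th j + alpha)) 1 N
              = cos b * S + - sin b * C).
  { rewrite (sum_n_m_ext _
      (fun k => plus (mult (cos b) (sin (th k - th N + alpha)))
                     (mult (- sin b) (cos (th k - th N + alpha))))).
    - rewrite sum_n_m_plus, 2!(sum_n_m_mult_l (K := R_Ring)); reflexivity.
    - intros k.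
      replace (th k - th j + alpha) with ((th k - th N + alpha) - b)
        by (unfold b; ring).
      rewrite sin_minus; unfold plus, mult; simpl; ring. }
  rewrite E; ring.
Qed.

Lemma mean_abs_le (N : nat) (kappa : R) (u : nat -> R)
    (hu : forall k, Rabs (u k) <= 1) :
  Rabs (kappa / INR N * sum_n_m u 1 N) <= Rabs (kappa / INR N) * INR N.
Proof.
  rewrite Rabs_mult.
  apply Rmult_le_compat_l; [apply Rabs_pos | apply sum_n_m_abs_le, hu].
Qed.

(** The lower bound keeps the other oscillators away from [theta N]; the upper bound keeps the
    cluster together. *)
Lemma one_sub_cos_growth (N : nat) (kappa alpha : R)
    (theta0 : nat -> R) (theta : nat -> R -> R) (j : nat)
    (hsol : solves_ivp N (sakaguchi_kuramoto N kappa alpha) theta0 theta)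
    (hj : (1 <= j <= N)%nat) :
  exists K : R, forall t, 0 <= t ->
    (1 - cos (theta0 j - theta0 N)) * exp (- (K * t))
      <= 1 - cos (theta j t - theta N t)
      <= (1 - cos (theta0 j - theta0 N)) * exp (K * t).
Proof.
  destruct (hsol j hj) as [cj [dj ij]].
  destruct (hsol N) as [cN [dN iN]]; [lia | ].
  set (M := Rabs (kappa / INR N) * INR N).
  (* [M] bounds both P and Q, while sin b is at most 1 and 1 + cos b at most 2 in absolute value: M
     + 2 M. *)
  exists (3 * M); intros t ht.
  rewrite <- ij, <- iN.
  set (P := fun s => mean_sin N kappa alpha (fun k => theta k s)).
  set (Q := fun s => mean_cos N kappa alpha (fun k => theta k s)).
  set (b := fun s => theta j s - theta N s).
  apply (linear_ode_bounds (fun s => 1 - cos (b s))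
           (fun s => - (P s * sin (b s) + Q s * (1 + cos (b s))))).
  - apply (continuous_on_comp_pt _ b (fun y => 1 - cos y)).
    + apply continuous_on_Rminus; [exact cj | exact cN].
    + intros x _; apply (ex_derive_continuous (fun y => 1 - cos y)); auto_derive; trivial.
  - intros s hs.
    (* The right side is b' sin b; replacing sin^2 by (1 - cos) (1 + cos) in its Q term brings out
       the factor 1 - cos b. *)
    replace (- (P s * sin (b s) + Q s * (1 + cos (b s))) * (1 - cos (b s)))
      with ((- P s * (1 - cos (b s)) - Q s * sin (b s)) * sin (b s)).
    2: { pose proof (sin2_cos2 (b s)) as E; unfold Rsqr in E.
         transitivity (- P s * (1 - cos (b s)) * sin (b s)
                       - Q s * (sin (b s) * sin (b s))); [ring | ].
         replace (sin (b s) * sin (b s)) with (1 - cos (b s) * cos (b s)) by lra.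
         ring. }
    apply is_derive_one_sub_cos.
    unfold P, Q, b; rewrite <- (sakaguchi_kuramoto_sub N kappa alpha (fun k => theta k s) j).
    apply (is_derive_minus (K := R_AbsRing) (V := R_NormedModule)); [apply dj | apply dN]; exact hs.
  - intros s.
    assert (hP : Rabs (P s) <= M).
    { apply mean_abs_le; intros k; apply Rabs_le, SIN_bound. }
    assert (hQ : Rabs (Q s) <= M).
    { apply mean_abs_le; intros k; apply Rabs_le, COS_bound. }
    rewrite Rabs_Ropp.
    eapply Rle_trans; [apply Rabs_triang | ].
    rewrite 2!Rabs_mult.
    assert (hs : Rabs (sin (b s)) <= 1) by apply Rabs_le, SIN_bound.
    assert (hc : Rabs (1 + cos (b s)) <= 2).
    { pose proof (COS_bound (b s)); apply Rabs_le; lra. }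
    pose proof (Rmult_le_compat _ _ _ _ (Rabs_pos _) (Rabs_pos _) hP hs).
    pose proof (Rmult_le_compat _ _ _ _ (Rabs_pos _) (Rabs_pos _) hQ hc).
    lra.
  - intros s; apply one_sub_cos_nonneg.
  - exact ht.
Qed.

(** Used with [u] the sine or cosine of an angle shifted by [alpha], and [w] its rational form in
    the half-angle cotangent. The cluster hypothesis concerns values of [u], so coincidence modulo 2
    pi suffices. *)
Lemma sum_split_cluster (N m : nat) (th : nat -> R) (u w : R -> R)
    (hm : (m <= N)%nat)
    (hclu : forall k, (N - m + 1 <= k <= N)%nat -> u (th k - th N) = u 0)
    (hrest : forall k, (1 <= k <= N - m)%nat ->
       u (th k - th N) = w (sin_ratio (th k - th N))) :
  sum_n_m (fun k => u (th k - th N)) 1 N =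
  INR m * u 0 + sum_n_m (fun k => w (sin_ratio (th k - th N))) 1 (N - m).
Proof.
  (* For m = N the first block runs from 1 to 0 and is empty; the side condition 1 <= S (N - m)
     still holds. *)
  rewrite (sum_n_m_Chasles _ 1 (N - m) N) by lia.
  rewrite (sum_n_m_ext_loc (fun k => u (th k - th N)) (fun _ => u 0) (S (N - m)) N)
    by (intros k hk; apply hclu; lia).
  rewrite sum_n_m_const.
  replace (S N - S (N - m))%nat with m by lia.
  rewrite (sum_n_m_ext_loc (fun k => u (th k - th N))
             (fun k => w (sin_ratio (th k - th N))) 1 (N - m))
    by (intros k hk; apply hrest; lia).
  apply Rplus_comm.
Qed.

Theorem proposition3p1 (N m : nat) (kappa alpha : R)
    (theta0 : nat -> R) (theta : nat -> R -> R)
    (hN : (3 <= N)%nat) (hkappa : 0 < kappa) (hm : (1 <= m <= N)%nat)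
    (heq : forall j : nat, (N - m + 1 <= j <= N)%nat -> theta0 j = theta0 N)
    (hneq : forall j : nat, (1 <= j <= N - m)%nat ->
              ~ congr_2PI (theta0 j) (theta0 N))
    (hsol : solves_ivp N (sakaguchi_kuramoto N kappa alpha) theta0 theta) :
  (forall (j : nat) (t : R), (1 <= j <= N - m)%nat -> 0 <= t ->
     1 - cos (theta j t - theta N t) <> 0) /\
  solves_ivp (N - m)
    (fun x j => calA N m kappa alpha x + calB N m kappa alpha x * x j)
    (fun j => sin_ratio (theta0 j - theta0 N))
    (fun j t => sin_ratio (theta j t - theta N t)).
Proof.
  assert (hne : forall (j : nat) (t : R), (1 <= j <= N - m)%nat -> 0 <= t ->
     1 - cos (theta j t - theta N t) <> 0).
  { intros j t hj ht.
    destruct (one_sub_cos_growth N kappa alpha theta0 theta j hsol) as [K HK]; [lia | ].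
    specialize (HK t ht).
    assert (g0 : 0 < 1 - cos (theta0 j - theta0 N)).
    { destruct (one_sub_cos_nonneg (theta0 j - theta0 N)) as [H | H]; [exact H | ].
      exfalso; apply (hneq j hj), one_sub_cos_eq0; symmetry; exact H. }
    pose proof (Rmult_lt_0_compat _ _ g0 (exp_pos (- (K * t)))); lra. }
  (* Cluster phases are only shown equal modulo 2 pi, which is all that the sums of sines and
     cosines detect. *)
  assert (hclu : forall (j : nat) (t : R), (N - m + 1 <= j <= N)%nat -> 0 <= t ->
     1 - cos (theta j t - theta N t) = 0).
  { intros j t hj ht.
    destruct (one_sub_cos_growth N kappa alpha theta0 theta j hsol) as [K HK]; [lia | ].
    specialize (HK t ht).
    rewrite (heq j hj), Rminus_diag, cos_0, Rminus_diag, !Rmult_0_l in HK; lra. }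
  split; [exact hne | ].
  intros j hj.
  destruct (hsol j) as [cj [dj ij]]; [lia | ].
  destruct (hsol N) as [cN [dN iN]]; [lia | ].
  split; [ | split].
  (* [hne] includes t = 0, so continuity of the ratio reaches the initial time. *)
  - apply (continuous_on_comp_pt _ (fun t => theta j t - theta N t) sin_ratio).
    + apply continuous_on_Rminus; [exact cj | exact cN].
    + intros x Dx; apply (ex_derive_continuous sin_ratio).
      eexists; apply (is_derive_sin_ratio (fun y => y)); [apply is_derive_id | apply hne; assumption].
  - intros t ht.
    set (th := fun k => theta k t).
    assert (ht0 : 0 <= t) by lra.
    assert (HP : calA N m kappa alpha (fun k => sin_ratio (th k - th N))
                 = mean_sin N kappa alpha th).
    { unfold calA, mean_sin; f_equal; symmetry.
      rewrite (sum_split_cluster N m th (fun b => sin (b + alpha))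
        (fun x => 2 * x / (x ^ 2 + 1) * cos alpha + (x ^ 2 - 1) / (x ^ 2 + 1) * sin alpha)).
      - rewrite Rplus_0_l; reflexivity.
      - lia.
      (* On the cluster the phase difference has sine 0 and cosine 1, the same as the angle 0. *)
      - intros k hk; pose proof (hclu k t hk ht0) as E.
        rewrite !sin_plus, sin_0, cos_0.
        unfold th; rewrite (sin_eq0_of_one_sub_cos_eq0 _ E).
        replace (cos (theta k t - theta N t)) with 1 by lra; reflexivity.
      - intros k hk.
        rewrite sin_of_sin_ratio, cos_of_sin_ratio by (apply hne; assumption).
        apply sin_plus. }
    assert (HQ : calB N m kappa alpha (fun k => sin_ratio (th k - th N))
                 = mean_cos N kappa alpha th).
    { unfold calB, mean_cos; f_equal; symmetry.
      rewrite (sum_split_cluster N m th (fun b => cos (b + alpha))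
        (fun x => - (2 * x / (x ^ 2 + 1)) * sin alpha + (x ^ 2 - 1) / (x ^ 2 + 1) * cos alpha)).
      - rewrite Rplus_0_l; reflexivity.
      - lia.
      - intros k hk; pose proof (hclu k t hk ht0) as E.
        rewrite !cos_plus, sin_0, cos_0.
        unfold th; rewrite (sin_eq0_of_one_sub_cos_eq0 _ E).
        replace (cos (theta k t - theta N t)) with 1 by lra; reflexivity.
      - intros k hk.
        rewrite sin_of_sin_ratio, cos_of_sin_ratio by (apply hne; assumption).
        rewrite cos_plus; ring. }
    change (is_derive (fun s => sin_ratio (theta j s - theta N s)) t
      (calA N m kappa alpha (fun k => sin_ratio (th k - th N)) +
       calB N m kappa alpha (fun k => sin_ratio (th k - th N)) * sin_ratio (th j - th N))).
    rewrite HP, HQ.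
    assert (hb : 1 - cos (th j - th N) <> 0) by (apply hne; assumption).
    replace (mean_sin N kappa alpha th + mean_cos N kappa alpha th * sin_ratio (th j - th N))
      with (- (sakaguchi_kuramoto N kappa alpha th j - sakaguchi_kuramoto N kappa alpha th N)
              / (1 - cos (th j - th N))).
    2: { rewrite sakaguchi_kuramoto_sub; unfold sin_ratio; field; exact hb. }
    apply (is_derive_sin_ratio (fun s => theta j s - theta N s)); [ | exact hb].
    apply (is_derive_minus (K := R_AbsRing) (V := R_NormedModule)); [apply dj | apply dN]; exact ht.
  - rewrite ij, iN; reflexivity.
Qed.
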